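(* Let $S=\langle a_1,\ldots,a_e\rangle$ be a numerical semigroup with minimal generators $a_1<\cdots<a_e$ and genus $g$ such that $a_e=2g+1$, and let $T=S\cup\{a_e-a_1\}$ (which is again a numerical semigroup). Assume $T\neq\mathbb{N}$. Then $T$ satisfies Wilf's inequality $$\frac{g(T)}{F(T)+1}\le\frac{e(T)-1}{e(T)}.$$
   Context: A numerical semigroup is a submonoid $S$ of $(\mathbb{N},+)$ (with $0\in\mathbb{N}$) whose complement in $\mathbb{N}$ is finite. It has a unique finite minimal generating set. Writing $S=\langle a_1,\ldots,a_e\rangle$ with $a_1<\cdots<a_e$ means that $a_1,\ldots,a_e$ are exactly the minimal generators of $S$. For a numerical semigroup $T$, the embedding dimension $e(T)$ is the number of minimal generators of $T$, the genus $g(T)$ is the number of positive integers not in $T$, and the Frobenius element $F(T)$ is the largest integer not in $T$. Above, $g=g(S)$. *)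

(* Defs.v *)
From HB Require Import structures.
From mathcomp Require Import all_boot all_order all_algebra.
From mathcomp Require Import finmap.
From mathcomp Require Import boolp classical_sets functions cardinality.

Set Implicit Arguments.
Unset Strict Implicit.
Unset Printing Implicit Defensive.

Import Order.TTheory GRing.Theory Num.Theory.

Local Open Scope classical_set_scope.

Definition submonoid (M : set nat) : Prop :=
  M 0%N /\ forall x y, M x -> M y -> M (x + y)%N.

Definition numerical_semigroup (S : set nat) : Prop :=
  submonoid S /\ finite_set (~` S).

Definition generated (A : set nat) : set nat := smallest submonoid A.

Definition minimal_generating_set (S A : set nat) : Prop :=
  generated A = S /\ forall B, B `<=` A -> generated B = S -> B = A.

(* The default [set0] of [xget] is not reached when S is a numerical semigroup,
   which has exactly one minimal generating set. *)
Definition minimal_generators (S : set nat) : set nat :=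
  xget set0 [set A | minimal_generating_set S A].

Definition embedding_dimension (S : set nat) : nat :=
  #|` fset_set (minimal_generators S)|.

Definition genus (S : set nat) : nat :=
  #|` fset_set ([set n | (0 < n)%N] `\` S)|.

(* The maximum is taken over the integers, so that it also exists, and equals
   -1, for S = setT. *)
Definition frobenius (S : set nat) : int :=
  let gaps : set int := ~` (Posz @` S) in
  xget 0%R (gaps `&` ubound gaps).

Definition wilf (S : set nat) : Prop :=
  ((genus S)%:R / ((frobenius S)%:~R + 1)
     <= ((embedding_dimension S)%:R - 1) / (embedding_dimension S)%:R :> rat)%R.

(* Main.v *)
Require Import Defs.
From mathcomp Require Import all_boot all_order all_algebra.
From mathcomp Require Import finmap.
From mathcomp Require Import boolp classical_sets functions cardinality.
From mathcomp Require Import zify.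

(** If [g = 0] then [S] and [T] are all of [nat]. Otherwise write
    [c = a_e = 2g + 1], [m = a_1] and [d = c - m].

    Since [c] is not a sum of two nonzero elements of [S], each of the [g] pairs
    [{i, c - i}], [1 <= i <= g], contains a gap of [S]. There are only [g] gaps,
    so each pair contains exactly one and there are no others: for [0 < x < c],
    [x] lies in [S] iff [c - x] does not ([gap_reflection]). In other words
    [S] without [c] is a symmetric semigroup with Frobenius number [c]. The
    largest gap of [S] is then [d], so [T = S u {d}] is a semigroup, whose gaps
    are the [c - y] with [y] in [S], [0 < y < c] and [y <> m] ([gap_adjoin]).

    Such a [y] is [b + t] with [t] in [S] and [b] either a generator other than
    [m] or [2m] ([summand_not_multiplicity]), and then [(c - y) + t = c - b] is
    again a gap of [T]. So every gap of [T] is [p - t] with [t] in [T], [t] below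
    the Frobenius number of [T], and [p] in the set of the [c - b]. If this
    set has fewer than [e(T)] elements, there are at most
    [(e(T) - 1) (F(T) + 1 - g(T))] gaps, which is Wilf's inequality; this is the
    argument of Froberg, Gottlieb and Haggkvist bounding the genus by the type
    ([wilf_of_gap_cover]).

    It remains to bound [e(T)] from below ([wilf_adjoin]). The element [d] is a
    minimal generator of [T], and so is every generator of [S] below [c] except
    possibly [2d]: a new decomposition must use [d], and adding to [d] a nonzero
    element of [S] reaches [c]. Compare this with the number of the [b]: the
    generators of [S] strictly between [m] and [c], and [2m] if [2m < c]. If
    [2m < c] then [c < 2d], so no generator is lost; otherwise [2m] is not among
    the [b], which compensates for the possible loss of [2d]. *)

Set Implicit Arguments.
Unset Strict Implicit.
Unset Printing Implicit Defensive.

Import Order.TTheory GRing.Theory Num.Theory.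

Local Open Scope classical_set_scope.

(** * Minimal generators as irreducible elements *)

Definition atom (M : set nat) : set nat :=
  [set x | [/\ M x, (0 < x)%N &
    forall y z, M y -> M z -> (0 < y)%N -> (0 < z)%N -> x <> (y + z)%N]].

Lemma atom_summand (M : set nat) x :
  submonoid M -> M x -> (0 < x)%N ->
  exists b t, [/\ atom M b, M t & x = (b + t)%N].
Proof.
move=> [M0 MD]; have [n] := ubnP x; elim: n x => // n IH x xn Mx x0.
have [ax|nax] := pselect (atom M x); first by exists x, 0%N; rewrite addn0.
have [y [z [My Mz y0 z0 xE]]] :
    exists y z, [/\ M y, M z, (0 < y)%N, (0 < z)%N & x = (y + z)%N].
  apply: contrapT => nd; apply: nax; split=> // y z My Mz y0 z0 xE.
  by apply: nd; exists y, z.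
have yn : (y < n)%N by lia.
have [b [t [ab Mt yE]]] := IH y yn My y0.
exists b, (t + z)%N; split=> //; first exact: MD.
by rewrite xE yE addnA.
Qed.

Lemma generated_submonoid (A : set nat) : submonoid (generated A).
Proof.
split=> [M [[M0 _] _] //|x y Ax Ay M [Ms AM]].
by apply: (proj2 Ms); [apply: Ax | apply: Ay].
Qed.

Lemma generated_atom (M : set nat) : submonoid M -> generated (atom M) = M.
Proof.
move=> Ms; apply/seteqP; split=> [x Gx|x].
  by apply: Gx; split=> // y [].
have [n] := ubnP x; elim: n x => // n IH x xn Mx.
have [->|x0] := posnP x; first exact: (proj1 (generated_submonoid _)).
have [b [t [ab Mt xE]]] := atom_summand Ms Mx x0.
have b0 : (0 < b)%N by case: ab.
rewrite xE; apply: (proj2 (generated_submonoid _)).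
  by move=> N [_]; apply.
by apply: IH => //; lia.
Qed.

(** If an irreducible [x] were missing from [A], then [M] without [x] would
    still be a submonoid containing [A], so [A] could not generate [M]. *)
Lemma atom_sub_generators (A M : set nat) :
  generated A = M -> atom M `<=` A.
Proof.
move=> GA x [Mx x0 xirr]; apply: contrapT => nAx.
have [M0 MD] : submonoid M by rewrite -GA; exact: generated_submonoid.
have AM : A `<=` M by rewrite -GA => y Ay N [_]; apply.
suff : (M `\ x) x by case=> _; apply.
rewrite -GA in Mx; apply: Mx; split=> [|y Ay]; last first.
  by split; [exact: AM | move=> yx; apply: nAx; rewrite -yx].
split=> [|y z [My yx] [Mz zx]]; first by split=> //= x0E; rewrite -x0E in x0.
split; first exact: MD.
have [->|y0] := posnP y; first exact: zx.
have [->|z0] := posnP z; first by rewrite addn0; exact: yx.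
by move=> /esym; apply: xirr.
Qed.

Lemma minimal_generating_setP (M A : set nat) :
  submonoid M -> minimal_generating_set M A <-> A = atom M.
Proof.
move=> Ms; split=> [[GA minA]|->].
  apply/esym/minA; last exact: generated_atom.
  exact: atom_sub_generators.
split=> [|B BA GB]; first exact: generated_atom.
by apply/seteqP; split=> //; apply: atom_sub_generators.
Qed.

Lemma minimal_generatorsE (M : set nat) :
  submonoid M -> minimal_generators M = atom M.
Proof.
move=> Ms; rewrite /minimal_generators; case: xgetP => [A _|].
  by move=> /(minimal_generating_setP _ Ms).
by move=> /(_ (atom M)) []; apply/minimal_generating_setP.
Qed.

Lemma finite_gaps_bounded (T : set nat) :
  finite_set (~` T) -> exists N, forall x, ~ T x -> (x < N)%N.
Proof.
move=> fT; exists (\max_(i <- fset_set (~` T)) i).+1 => x nTx.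
rewrite ltnS; apply: (@leq_bigmax_seq _ _ xpredT id) => //.
by rewrite in_fset_set // inE.
Qed.

Lemma bounded_finite (A : set nat) N :
  (forall x, A x -> (x < N)%N) -> finite_set A.
Proof.
by move=> AN; apply: (sub_finite_set _ (finite_II N)) => x /AN.
Qed.

(** A large element is a sum of two elements past the last gap. *)
Lemma finite_atom (T : set nat) : numerical_semigroup T -> finite_set (atom T).
Proof.
move=> [_ /finite_gaps_bounded [N NT]].
have TN x : (N <= x)%N -> T x.
  by move=> Nx; apply: contrapT => /NT; rewrite ltnNge Nx.
apply: (@bounded_finite _ (N.+1 + N.+1)) => x [_ _ xirr].
rewrite ltnNge; apply/negP => xN.
apply: (xirr N.+1 (x - N.+1)%N); [apply: TN|apply: TN|..]; lia.
Qed.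

Lemma leq_embedding_dimension (T : set nat) (s : seq nat) :
  numerical_semigroup T -> uniq s -> (forall x, x \in s -> atom T x) ->
  (size s <= embedding_dimension T)%N.
Proof.
move=> Tns us sT; rewrite /embedding_dimension minimal_generatorsE; last by case: Tns.
apply: uniq_leq_size => // x /sT ax.
by rewrite in_fset_set ?inE//; exact: finite_atom.
Qed.

(** * Counting gaps and Wilf's inequality *)

(** A proper numerical semigroup has a gap in [nat], so the negative integers
    among the gaps do not affect the maximum. *)
Lemma frobenius_gap (T : set nat) :
  finite_set (~` T) -> T <> setT ->
  exists f, [/\ ~ T f, forall x, ~ T x -> (x <= f)%N & frobenius T = f%:Z%R].
Proof.
move=> /finite_gaps_bounded [N NT] TN.
have gapex : exists x, ~~ `[< T x >].
  apply: contrapT => noex; apply: TN; apply/seteqP; split=> // x _.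
  by apply: contrapT => nTx; apply: noex; exists x; apply/asboolPn.
have gaple x : ~~ `[< T x >] -> (x <= N)%N by move=> /asboolPn /NT /ltnW.
have [f /asboolPn nTf fmax] := ex_maxnP gapex gaple.
have fge x : ~ T x -> (x <= f)%N by move=> /asboolPn /fmax.
have fgap : (~` (Posz @` T)) (f%:Z%R) by move=> [y Ty [yf]]; rewrite yf in Ty.
have fub : ubound (~` (Posz @` T)) (f%:Z%R).
  move=> [x|x] nx; last by [].
  by rewrite lez_nat; apply: fge => Tx; apply: nx; exists x.
exists f; split=> //; rewrite /frobenius; case: xgetP => [z _ [zgap zub]|].
  by apply/eqP; rewrite eq_le fub //= zub.
by move=> /(_ f%:Z%R) [].
Qed.

Lemma genus_count (T : set nat) f :
  T 0%N -> (forall x, ~ T x -> (x <= f)%N) ->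
  genus T = count (fun x => ~~ `[< T x >]) (iota 0 f.+1).
Proof.
move=> T0 fge; rewrite /genus -size_filter.
have fin : finite_set ([set n | (0 < n)%N] `\` T).
  by apply: (@bounded_finite _ f.+1) => x [_ /fge].
apply/eqP; rewrite eqn_leq; apply/andP; split.
  apply: uniq_leq_size => // x; rewrite in_fset_set // inE => -[_ nTx].
  by rewrite mem_filter mem_iota /= add0n ltnS fge // andbT; apply/asboolPn.
apply: uniq_leq_size; first by rewrite filter_uniq ?iota_uniq.
move=> x; rewrite mem_filter => /andP[/asboolPn nTx _].
rewrite in_fset_set // inE; split=> //=.
by case: x nTx => // /(_ T0).
Qed.

(** Every gap is [p - t] with [p] in [P] and [t] in [T]; as [p] is a gap too,
    [t < F(T)]. There are [n = F(T) + 1 - g(T)] such [t], so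
    [g(T) <= (e(T) - 1) n], and adding [(e(T) - 1) g(T)] to both sides gives
    [e(T) g(T) <= (e(T) - 1) (F(T) + 1)]. With [P] the set of pseudo-Frobenius
    numbers this is the classical criterion that Wilf's inequality holds when
    the type is less than the embedding dimension. *)
Lemma wilf_of_gap_cover (T : set nat) (P : seq nat) :
  numerical_semigroup T -> T <> setT ->
  (forall x, ~ T x -> exists p t, [/\ p \in P, ~ T p, T t & (x + t)%N = p]) ->
  (size P < embedding_dimension T)%N -> wilf T.
Proof.
move=> [[T0 TD] finT] TN cover sizeP.
have [f [nTf fge frobE]] := frobenius_gap finT TN.
set N := [seq t <- iota 0 f.+1 | `[< T t >]].
have gN : (genus T + size N = f.+1)%N.
  by rewrite (genus_count T0 fge) size_filter addnC count_predC size_iota.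
have gPN : (genus T <= size P * size N)%N.
  rewrite (genus_count T0 fge) -size_filter -(size_allpairs (fun p t => p - t)%N).
  apply: uniq_leq_size; first by rewrite filter_uniq ?iota_uniq.
  move=> x; rewrite mem_filter => /andP[/asboolPn /cover [p [t [pP nTp Tt xtp]]] _].
  apply/allpairsP; exists (p, t); split=> //=; last by lia.
  rewrite mem_filter mem_iota; apply/andP; split; first exact/asboolP.
  by have := fge _ nTp; lia.
rewrite /wilf frobE; move: (embedding_dimension T) (genus T) sizeP gN gPN => e g sizeP gN gPN.
have key : (g * e <= (e - 1) * f.+1)%N.
  have : (g <= (e - 1) * size N)%N.
    by apply: (leq_trans gPN); apply: leq_mul => //; lia.
  by rewrite -gN; nia.
have e1 : (0 < e)%N by lia.
rewrite (_ : (f%:Z%:~R + 1)%R = f.+1%:R :> rat)%R; last by rewrite -natr1.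
rewrite -(natrB _ e1) ler_pdivrMr ?ltr0n // mulrAC ler_pdivlMr ?ltr0n //.
by rewrite -!natrM ler_nat.
Qed.

(** * Semigroups with 2g + 1 as a minimal generator *)

(** The [g] pairs [{i, c - i}], with [c = 2g + 1], each contain a gap since [c]
    is irreducible. Choosing one gap [phi i] per pair gives [g] distinct gaps,
    hence all of them, so no pair contains two. *)
Lemma gap_reflection (S : set nat) :
  numerical_semigroup S -> atom S (2 * genus S + 1)%N ->
  (forall x, ~ S x -> (x <= 2 * genus S)%N) /\
  (forall x, (0 < x)%N -> (x <= 2 * genus S)%N ->
     S x <-> ~ S (2 * genus S + 1 - x)%N).
Proof.
move=> [[S0 SD] finS] [Sc _ cirr]; set g := genus S.
have [N NT] := finite_gaps_bounded finS.
pose gaps := [seq x <- iota 0 N.+1 | ~~ `[< S x >]].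
have sgaps : size gaps = g.
  by rewrite size_filter -genus_count // => x /NT /ltnW.
pose phi x := if `[< S x >] then (2 * g + 1 - x)%N else x.
have gapphi x : (0 < x)%N -> (x <= g)%N -> ~ S (phi x).
  move=> x0 xg; rewrite /phi; case: asboolP => // Sx Sx'.
  by apply: (cirr x _ Sx Sx'); rewrite -/g; lia.
have phiE x : phi x = x \/ phi x = (2 * g + 1 - x)%N.
  by rewrite /phi; case: asboolP; [right | left].
have uphi : uniq (map phi (iota 1 g)).
  rewrite map_inj_in_uniq ?iota_uniq // => x y; rewrite !mem_iota.
  by case: (phiE x) => ->; case: (phiE y) => ->; lia.
have phigaps : {subset map phi (iota 1 g) <= gaps}.
  move=> y /mapP [x]; rewrite mem_iota => xg ->.
  have nS : ~ S (phi x) by apply: gapphi; lia.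
  by rewrite mem_filter mem_iota /= add0n ltnS ltnW ?NT // andbT; apply/asboolPn.
have gapsE : gaps =i map phi (iota 1 g).
  move=> x; have [] := uniq_min_size uphi phigaps; last by move=> _ ->.
  by rewrite sgaps size_map size_iota.
have gapP x : ~ S x -> exists2 i, (0 < i <= g)%N & x = phi i.
  move=> nSx; have : x \in gaps.
    by rewrite mem_filter mem_iota /= add0n ltnS ltnW ?NT // andbT; apply/asboolPn.
  by rewrite gapsE => /mapP [i]; rewrite mem_iota => ig ->; exists i => //; lia.
split=> [x /gapP [i ig ->]|x x0 xg].
  by case: (phiE i) => ->; lia.
split=> [Sx Sx'|nSx']; first by apply: (cirr x _ Sx Sx'); rewrite -/g; lia.
apply: contrapT => nSx.
have [i ig xE] := gapP _ nSx; have [j jg x'E] := gapP _ nSx'.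
have ij : i = j by case: (phiE i) (phiE j) => + [] => *; lia.
by rewrite -ij in x'E; lia.
Qed.

(** * Adjoining the reflection of the multiplicity *)

Lemma numerical_semigroup_adjoin (S : set nat) d :
  numerical_semigroup S ->
  (forall s, S s -> (0 < s)%N -> S (d + s)%N) -> S (d + d)%N ->
  numerical_semigroup (S `|` [set d]).
Proof.
move=> [[S0 SD] finS] SdD Sdd; split; last first.
  by apply: sub_finite_set finS; apply: subsetC => x; left.
have SdD' x : S x -> (S `|` [set d]) (d + x)%N.
  by have [-> _|x0 Sx] := posnP x; [right; rewrite addn0 | left; apply: SdD].
split=> [|x y [Sx|->] [Sy|->]]; first by left.
- by left; apply: SD.
- by rewrite addnC; apply: SdD'.
- exact: SdD'.
- by left.
Qed.

Lemma gap_adjoin (S : set nat) c m d y :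
  numerical_semigroup S -> atom S c -> c = (2 * genus S + 1)%N -> c = (d + m)%N ->
  ~ (S `|` [set d]) y <->
  [/\ (0 < y)%N, (y < c)%N, S (c - y)%N & (c - y)%N <> m].
Proof.
move=> Sns ac cE cdm; rewrite cE in ac.
have [gapc refl] := gap_reflection Sns ac; rewrite -cE in refl.
split=> [nTy|[y0 yc Sy ym] [Sy'|/= yd]]; last 2 first.
- by apply: (iffLR (refl y _ _) Sy') => //; lia.
- by apply: ym; lia.
have nSy : ~ S y by move=> Sy; apply: nTy; left.
have y0 : (0 < y)%N.
  by rewrite lt0n; apply/eqP => y0; apply: nSy; rewrite y0; case: Sns => -[].
have yg := gapc _ nSy; have yc : (y < c)%N by lia.
split=> //; first by apply: contrapT => nS; apply: nSy; apply/refl.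
by move=> ym; apply: nTy; right => /=; lia.
Qed.

(** An element other than [m] whose irreducible summands all equal [m] is a
    multiple [k m] with [k >= 2], so [2m] can be split off. *)
Lemma summand_not_multiplicity (S : set nat) m y :
  submonoid S -> S m -> S y -> (0 < y)%N -> y <> m ->
  exists b t, [/\ b = (m + m)%N \/ atom S b /\ b <> m, S t & y = (b + t)%N].
Proof.
move=> Ssub Sm Sy y0 ym; have [_ SD] := Ssub.
have [b [t [ab St yE]]] := atom_summand Ssub Sy y0.
have [bm|/eqP bm] := eqVneq b m; last by exists b, t; split=> //; right.
have t0 : (0 < t)%N by rewrite lt0n; apply/eqP => t0; apply: ym; rewrite yE bm t0 addn0.
have [b' [t' [ab' St' tE]]] := atom_summand Ssub St t0.
have [b'm|/eqP b'm] := eqVneq b' m.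
  by exists (m + m)%N, t'; split; [left | | rewrite yE bm tE b'm addnA].
exists b', (m + t')%N; split; [by right|exact: SD|].
by rewrite yE bm tE addnCA.
Qed.

Lemma atom_adjoin_gap (S : set nat) d : submonoid S -> (0 < d)%N -> ~ S d ->
  atom (S `|` [set d]) d.
Proof.
move=> [_ SD] d0 nSd; split=> [||y z [Sy|/= yd] [Sz|/= zd] y0 z0 dE]; [by right|by []|..];
  [by apply: nSd; rewrite dE; apply: SD|lia|lia|lia].
Qed.

(** A decomposition of [b] in the larger monoid that is not one in [S] uses [d];
    its other summand is then [d] itself or at least [m], and [d + m = c] is too
    large. *)
Lemma atom_adjoin (S : set nat) c m d b :
  (forall x, S x -> (0 < x)%N -> (m <= x)%N) -> c = (d + m)%N ->
  atom S b -> (b < c)%N -> b <> (d + d)%N -> atom (S `|` [set d]) b.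
Proof.
move=> mmin cdm [Sb b0 birr] bc bdd; split=> [||y z [Sy|/= yd] [Sz|/= zd] y0 z0 bE];
  [by left|by []|exact: (birr y z)| | |].
- by have := mmin _ Sy y0; lia.
- by have := mmin _ Sz z0; lia.
- by apply: bdd; rewrite bE yd zd.
Qed.

(** The differences [c - b], for [b] in the list [B] of the proof, form the
    covering set of gaps required by [wilf_of_gap_cover]. *)
Lemma wilf_adjoin (S : set nat) (c m d : nat) (a : seq nat) :
  numerical_semigroup S -> atom S c -> c = (2 * genus S + 1)%N ->
  uniq (m :: a) -> (forall x, x \in m :: a <-> atom S x) ->
  (forall x, S x -> (0 < x)%N -> (m <= x)%N) ->
  (0 < d)%N -> c = (d + m)%N ->
  numerical_semigroup (S `|` [set d]) -> S `|` [set d] <> setT ->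
  wilf (S `|` [set d]).
Proof.
move=> Sns ac cE uma maP mmin d0 cdm; set T := S `|` [set d] => Tns TN.
have Ssub : submonoid S by case: Sns.
have [Sm m0 _] : atom S m by apply/maP; rewrite mem_head.
have [Sc c0 cirr] := ac.
have nSd : ~ S d by move=> Sd; apply: (cirr d m).
have gapT y := gap_adjoin y Sns ac cE cdm.
pose a' := [seq b <- a | (b < c)%N].
pose B := a' ++ [seq b <- [:: (m + m)%N] | (b < c)%N].
have BS b : b \in B -> [/\ (0 < b)%N, (b < c)%N, S b & b <> m].
  rewrite mem_cat !mem_filter inE => /orP[/andP[bc ba]|/andP[bc /eqP bE]].
    have [Sb b0 _] : atom S b by apply/maP; rewrite inE ba orbT.
    split=> // bm; move: uma; rewrite /= -bm ba //.
  split=> //; [lia|by rewrite bE; apply: (proj2 Ssub)|lia].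
apply: (@wilf_of_gap_cover T [seq (c - b)%N | b <- B]) => //.
  move=> x /gapT [x0 xc Scx cxm].
  have cx0 : (0 < c - x)%N by lia.
  have [b [t [bE St xE]]] := summand_not_multiplicity Ssub Sm Scx cx0 cxm.
  have bc : (b < c)%N by lia.
  have bB : b \in B.
    rewrite mem_cat !mem_filter bc inE /=; case: bE => [->|[/maP]].
      by rewrite eqxx orbT.
    by rewrite inE => /orP[/eqP//|-> //].
  have [b0 _ Sb bm] := BS _ bB.
  exists (c - b)%N, t; split; [exact: map_f| |by left|by lia].
  by apply/gapT; rewrite subKn ?(ltnW bc) //; split=> //; lia.
have atomd : atom T d by apply: atom_adjoin_gap.
(* The new generator [d] comes on top of the generators kept from [S], so the
   inequality is strict. *)
have sizeP s : uniq s -> {subset s <= m :: a'} ->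
    (forall b, b \in s -> b <> (d + d)%N) -> (size s < embedding_dimension T)%N.
  move=> us sma sdd; have sS b : b \in s -> atom S b /\ (b < c)%N.
    move=> /sma; rewrite inE mem_filter => /orP[/eqP ->|/andP[bc ba]].
      by split; [apply/maP; rewrite mem_head | lia].
    by split=> //; apply/maP; rewrite inE ba orbT.
  apply: (@leq_embedding_dimension T (d :: s)) => //.
    by rewrite /= us andbT; apply/negP => /sS [[]].
  move=> x; rewrite inE => /orP[/eqP -> //|xs].
  by have [ax xc] := sS _ xs; apply: (atom_adjoin mmin cdm ax xc); apply: sdd.
have uma' : uniq (m :: a').
  by move: uma; rewrite /= mem_filter negb_and => /andP[-> ua]; rewrite orbT filter_uniq.
(* If [2m < c] then [d > m], so [2d > c]: nothing in [m :: a'] is lost.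
   Otherwise [B] is [a'], and there is room to drop [2d] from [m :: a']. *)
rewrite size_map size_cat /=; case: ifP => mmc.
  rewrite addn1; apply: (sizeP (m :: a')) => // b.
  rewrite inE mem_filter => /orP[/eqP ->|/andP[bc _]]; lia.
rewrite addn0; have [ddma|ddma] := boolP ((d + d)%N \in m :: a').
  rewrite -[size a']/((size (m :: a')).-1) -(size_rem ddma).
  apply: sizeP; [exact: rem_uniq|exact: mem_rem|].
  by move=> b bs bdd; move: bs; rewrite mem_rem_uniq // inE bdd eqxx.
apply/ltnW/(sizeP (m :: a')) => // b bs bdd.
by move: ddma; rewrite -bdd bs.
Qed.

Theorem theorem5p3 (S : set nat) (a : seq nat) :
  numerical_semigroup S ->
  sorted ltn a ->
  minimal_generating_set S [set` a] ->
  last 0%N a = (2 * genus S + 1)%N ->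
  let T := S `|` [set (last 0%N a - head 0%N a)%N] in
  numerical_semigroup T /\ (T <> setT -> wilf T).
Proof.
move=> Sns sa /minimal_generating_setP aS.
have Ssub : submonoid S by case: Sns.
have {}aS x : x \in a <-> atom S x by rewrite -aS.
case: a sa aS => [|m a] sa aS cE; first by rewrite /= addn1 in cE.
set c := last _ _ in cE *; set d := (c - _)%N => /=.
have ac : atom S c by apply/aS; rewrite /c /= mem_last.
clearbody c.
have ac' : atom S (2 * genus S + 1)%N by rewrite -cE.
have [gapc refl] := gap_reflection Sns ac'; rewrite -cE in refl.
have Sbig x : (2 * genus S < x)%N -> S x.
  by move=> cx; apply: contrapT => /gapc; rewrite leqNgt cx.
have uma : uniq (m :: a) by exact: (sorted_uniq ltn_trans ltnn).
have mmin x : S x -> (0 < x)%N -> (m <= x)%N.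
  move=> Sx x0; have [b [t [/aS bma _ ->]]] := atom_summand Ssub Sx x0.
  apply: leq_trans (leq_addr _ _).
  move: bma; rewrite inE => /orP[/eqP -> //|ba].
  have /allP /(_ _ ba) := order_path_min ltn_trans sa; exact: ltnW.
have [Sm m0 _] : atom S m by apply/aS; rewrite mem_head.
(* For genus 0 the semigroup is all of [nat], [m = c] and [d = 0]. *)
have [g0|g0] := posnP (genus S).
  have ST : S = setT.
    apply/seteqP; split=> // -[_|n _]; first by case: Ssub.
    by apply: Sbig; rewrite g0.
  have TT : S `|` [set d] = setT by rewrite ST setTU.
  by rewrite TT; split=> //; rewrite -ST.
have mc : (m < c)%N.
  (* Either [1] or its reflection [2g] lies in [S], and both are below [c]. *)
  have [S1|nS1] := pselect (S 1%N); first by have := mmin _ S1 isT; lia.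
  have S2g : S (2 * genus S)%N.
    by apply/refl; [lia| |rewrite cE addKn].
  by have := mmin _ S2g; lia.
have cdm : c = (d + m)%N by rewrite /d /= subnK // ltnW.
have d0 : (0 < d)%N by rewrite /d subn_gt0.
clearbody d.
have Tns : numerical_semigroup (S `|` [set d]).
  apply: numerical_semigroup_adjoin => // [s Ss s0|].
    by apply: Sbig; have := mmin _ Ss s0; lia.
  (* If [2d] were a gap, its reflection [c - 2d = m - d] would be a nonzero
     element of [S] below [m]. *)
  have [cdd|ddc] := leqP c (d + d); first by apply: Sbig; lia.
  by apply/refl; [lia|lia|] => /mmin; lia.
split=> //; exact: (wilf_adjoin Sns ac cE uma aS mmin d0 cdm Tns).
Qed.
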